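(* If $G$ is a graph on $n$ vertices, then $h_f(G)\le \sqrt{2\,h(G)\,n}$.
   Context: For a graph $G$, the Hadwiger number $h(G)$ is the largest $t$ such that the complete graph $K_t$ is a minor of $G$. A bramble for $G$ is a collection $\mathcal B$ of connected subgraphs of $G$ such that every pair $B,B'\in\mathcal B$ either shares a vertex or is joined by an edge of $G$ (with one end in $B$ and the other in $B'$). The fractional Hadwiger number $h_f(G)$ is the maximum of $\sum_{B\in\mathcal B} w(B)$ over all brambles $\mathcal B$ for $G$ and all weight functions $w:\mathcal B\to\mathbb R_{\ge 0}$ such that for every vertex $v$, the sum of $w(B)$ over all $B\in\mathcal B$ containing $v$ is at most $1$. *)

(* Defs.v *)
From HB Require Import structures.
From mathcomp Require Import all_boot all_order all_algebra.
From mathcomp Require Import all_classical all_reals all_analysis.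

Set Implicit Arguments.
Unset Strict Implicit.
Unset Printing Implicit Defensive.

Import Order.TTheory GRing.Theory Num.Theory.
Import numFieldNormedType.Exports.
Local Open Scope ring_scope.

Record sgraph := SGraph {
  vertex :> finType;
  adj : rel vertex;
  adj_sym : symmetric adj;
  adj_irr : irreflexive adj }.

Section Complete.
Variable t : nat.
Definition complete_adj : rel 'I_t := fun i j => i != j.
Lemma complete_sym : symmetric complete_adj.
Proof. by move=> i j; rewrite /complete_adj eq_sym. Qed.
Lemma complete_irr : irreflexive complete_adj.
Proof. by move=> i; rewrite /complete_adj eqxx. Qed.
Definition complete_graph : sgraph := SGraph complete_sym complete_irr.
End Complete.

Section Subgraphs.
Variable G : sgraph.

Definition edges : {set {set G}} :=
  [set [set p.1; p.2] | p in [set p : G * G | adj p.1 p.2]]%SET.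

(* A subgraph candidate is a pair (vertex set, edge set). *)
Definition presubgraph : finType := ({set G} * {set {set G}})%type.

Definition is_subgraph (H : presubgraph) : bool :=
  (H.2 \subset edges) && [forall E in H.2, E \subset H.1].

Definition subgraph_adj (H : presubgraph) : rel G :=
  fun x y => [set x; y]%SET \in H.2.

(* The null graph is not connected. *)
Definition connected_subgraph (H : presubgraph) : bool :=
  (H.1 != finset.set0) &&
  [forall x in H.1, forall y in H.1, connect (subgraph_adj H) x y].

Definition induced (X : {set G}) : presubgraph :=
  (X, [set E in edges | E \subset X]%SET).

Definition joined (X Y : {set G}) : bool :=
  [exists x in X, exists y in Y, adj x y].

Definition bramble (BB : {set presubgraph}) : bool :=
  [forall B in BB, is_subgraph B && connected_subgraph B] &&
  [forall B in BB, forall B' in BB,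
     ~~ [disjoint B.1 & B'.1] || joined B.1 B'.1].

End Subgraphs.

(* H is a minor of G: the vertices of H are modelled by pairwise disjoint
   connected branch sets in G, with an edge of G between the branch sets of any
   two adjacent vertices of H. *)
Definition minor (H G : sgraph) : bool :=
  [exists phi : {ffun H -> {set G}},
    [&& [forall u, connected_subgraph (induced (phi u))],
        [forall u, forall v, (u != v) ==> [disjoint phi u & phi v]] &
        [forall u, forall v, adj u v ==> joined (phi u) (phi v)]]].

(* The bound t <= #|G| loses nothing: see hadwiger_max. *)
Definition hadwiger (G : sgraph) : nat :=
  (\max_(t < #|G|.+1 | minor (complete_graph t) G) t)%N.

Section Fractional.
Variables (R : realType) (G : sgraph).
Local Open Scope classical_set_scope.

Definition fractional_weight (BB : {set presubgraph G})
    (w : presubgraph G -> R) : Prop :=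
  (forall B, B \in BB -> 0 <= w B) /\
  (forall v : G, \sum_(B in BB | v \in B.1) w B <= 1).

Definition bramble_totals : set R :=
  [set x | exists (BB : {set presubgraph G}) (w : presubgraph G -> R),
    [/\ bramble BB, fractional_weight BB w & x = \sum_(B in BB) w B]].

(* The supremum is a maximum: see frac_hadwiger_max. *)
Definition frac_hadwiger : R := sup bramble_totals.

End Fractional.
Arguments bramble_totals R G : clear implicits.

Lemma minor_complete_leq (G : sgraph) (t : nat) :
  minor (complete_graph t) G -> (t <= #|G|)%N.
Proof.
case/existsP=> phi /and3P[/forallP phiC /forallP phiD _].
have phi0 u : exists x, x \in phi u.
  by have /andP[/finset.set0Pn] := phiC u.
pose f (u : 'I_t) : G := xchoose (phi0 u).
have fP u : f u \in phi u by exact: xchooseP.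
rewrite -[t in (t <= _)%N]card_ord; apply: (@leq_card _ _ f) => u v fuv.
apply/eqP/negPn/negP => uv.
have /forallP/(_ v)/implyP/(_ uv)/pred0P/(_ (f u)) /= := phiD u.
by rewrite fP fuv fP.
Qed.

Lemma hadwiger_max (G : sgraph) :
  minor (complete_graph (hadwiger G)) G /\
  forall t, minor (complete_graph t) G -> (t <= hadwiger G)%N.
Proof.
split; last first.
  move=> t Gt; have tG : (t < #|G|.+1)%N by rewrite ltnS minor_complete_leq.
  by rewrite (@leq_bigmax_cond _ _ (fun t : 'I_(#|G|.+1) => t : nat) (Ordinal tG)).
have G0 : minor (complete_graph 0) G.
  apply/existsP; exists (finfun (fun _ => finset.set0)).
  by apply/and3P; split; apply/forallP => -[].
have [] := @eq_bigmax_cond _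
  [pred t : 'I_(#|G|.+1) | minor (complete_graph t) G] (fun t => t : nat).
  by apply/card_gt0P; exists ord0.
by move=> t Gt; rewrite /hadwiger => ->.
Qed.

Section FractionalMax.
Variables (R : realType) (G : sgraph).
Local Open Scope classical_set_scope.

Let W := prod_topology (fun _ : presubgraph G => R).

Lemma sum_weights_continuous (P : pred (presubgraph G)) :
  continuous (fun w : W => \sum_(B | P B) w B : R).
Proof.
apply: continuous_big; first exact: add_continuous.
by move=> B _; exact: (@proj_continuous _ (fun _ => R) B).
Qed.

Lemma weight_le1 (BB : {set presubgraph G}) (w : presubgraph G -> R) B :
  bramble BB -> fractional_weight BB w -> B \in BB -> w B <= 1.
Proof.
case/andP=> /forallP BBc _ [w0 w1] BBB.
have /implyP/(_ BBB)/andP[_ /andP[/finset.set0Pn[v vB] _]] := BBc B.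
apply: le_trans (w1 v); rewrite (bigD1 B) ?BBB //= lerDl.
by apply: sumr_ge0 => C /andP[/andP[CB _] _]; exact: w0.
Qed.

Lemma bramble_weight_max (BB : {set presubgraph G}) : bramble BB ->
  exists w : presubgraph G -> R, fractional_weight BB w /\
    forall w', fractional_weight BB w' ->
      \sum_(B in BB) w' B <= \sum_(B in BB) w B.
Proof.
move=> BBb.
pose box : set W := [set w | forall B, `[(0 : R), 1]%classic (w B)].
pose K : set W := box `&`
  \bigcap_(v in [set: G]) [set w : W | \sum_(B in BB | v \in B.1) w B <= 1].
have cK : compact K.
  apply: compact_closedI.
    apply: (@tychonoff _ (fun _ : presubgraph G => R)
      (fun _ => `[(0 : R), 1]%classic)) => B; exact: segment_compact.
  apply: closed_bigI => v _.
  apply: (@preimage_closed _ _ (fun w : W => \sum_(B in BB | v \in B.1) w B : R)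
    [set x | x <= 1]); last exact: closed_le.
  by move=> w _; exact: sum_weights_continuous.
have K0 : K !=set0.
  exists (fun _ => 0); split=> [B|v _] /=; first by rewrite in_itv /= lexx ler01.
  by rewrite big1.
have cf : {within K, continuous (fun w : W => \sum_(B in BB) w B : R)}.
  by apply: continuous_subspaceT; exact: sum_weights_continuous.
have [w /set_mem[wbox wK] wmax] := compact_EVT_max K0 cK cf.
exists w; split.
  split=> [B _|v]; last exact: wK.
  by have := wbox B; rewrite /= in_itv /= => /andP[].
move=> w' w'f.
pose w2 : W := fun B => if B \in BB then w' B else 0.
have w2E (P : pred (presubgraph G)) :
    \sum_(B in BB | P B) w2 B = \sum_(B in BB | P B) w' B.
  by apply: eq_bigr => B /andP[BB'B _]; rewrite /w2 BB'B.
have : w2 \in K.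
  apply/mem_set; split=> [B|v _] /=; last by rewrite w2E; exact: w'f.2.
  rewrite in_itv /= /w2; case: ifPn => [BBB|_]; last by rewrite lexx ler01.
  by rewrite (w'f.1 _ BBB) (weight_le1 BBb w'f BBB).
move/wmax; have := w2E predT.
by under eq_bigl do rewrite andbT; under [in RHS]eq_bigl do rewrite andbT; move=> ->.
Qed.

Lemma frac_hadwiger_max :
  bramble_totals R G (frac_hadwiger R G) /\
  ubound (bramble_totals R G) (frac_hadwiger R G).
Proof.
have b0 : bramble (finset.set0 : {set presubgraph G}).
  by apply/andP; split; apply/forallP => B; rewrite inE.
have /choice[w wP] : forall BB : {set presubgraph G}, exists w, bramble BB ->
    fractional_weight BB w /\ forall w' : presubgraph G -> R,
      fractional_weight BB w' -> \sum_(B in BB) w' B <= \sum_(B in BB) w B.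
  move=> BB; have [BBb|BBb] := boolP (bramble BB); last by exists (fun _ => 0).
  by have [w wP] := bramble_weight_max BBb; exists w.
pose total (BB : {set presubgraph G}) : R := \sum_(B in BB) w BB B.
have [BB BBb BBmax] := Order.TotalTheory.arg_maxP total b0.
have maxS : bramble_totals R G (\sum_(B in BB) w BB B).
  by exists BB, (w BB); split=> //; have [] := wP BB BBb.
have maxU : ubound (bramble_totals R G) (\sum_(B in BB) w BB B).
  move=> _ [CC [w' [CCb w'f ->]]]; apply: le_trans (BBmax CC CCb).
  by have [_] := wP CC CCb; apply.
suff -> : frac_hadwiger R G = \sum_(B in BB) w BB B by [].
apply/eqP; rewrite eq_le; apply/andP; split.
  by apply: ge_sup => //; eexists; exact: maxS.
by apply: ub_le_sup => //; eexists; exact: maxU.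
Qed.

End FractionalMax.

(* Main.v *)
(** Pick greedily a smallest bramble member [B_1], discard the members meeting
    it, pick a smallest remaining one [B_2], and so on. The chosen members are
    pairwise disjoint and touching, hence form a [K_k] minor, so [k <= h(G)].
    The members discarded with [B_i] have total weight [w_i <= |B_i|], since
    each of them contains a vertex of [B_i], and size at least [|B_i|]. Hence
    [n >= \sum_B w(B) |B| >= \sum_i w_i ^ 2 >= (\sum_i w_i) ^ 2 / k]. *)
Require Import Defs.
From HB Require Import structures.
From mathcomp Require Import all_boot all_order all_algebra.
From mathcomp Require Import all_classical all_reals.
From mathcomp Require Import ring lra.
Import Order.TTheory GRing.Theory Num.Theory.
Local Open Scope ring_scope.

(** Induction step of the Cauchy-Schwarz bound on a squared sum of [k] terms: a new term [c] joins
    the old sum [x], with [c ^+ 2] weakened to [c * a]. For [k > 0] it comes down to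
    [(k * c - x) ^+ 2 >= 0]. *)
Lemma sqr_add_le {R : realFieldType} (k : nat) (c a x t : R) :
  0 <= c -> c <= a -> x ^+ 2 <= k%:R * t -> 0 <= t ->
  (c + x) ^+ 2 <= k.+1%:R * (c * a + t).
Proof.
move=> c0 ca xt t0.
have cca : c ^+ 2 <= c * a by rewrite expr2 ler_wpM2l.
(* The main argument multiplies through by [k], so [k = 0] is separate: there [x ^+ 2 <= 0] forces
   [x = 0]. *)
case: k xt => [|k] xt.
  have -> : x = 0.
    by apply/eqP; rewrite -sqrf_eq0 eq_le sqr_ge0 andbT; rewrite mul0r in xt.
  by rewrite addr0 mul1r ler_wpDr.
have : 0 < k.+1%:R :> R by rewrite ltr0n.
rewrite -[k.+2%:R]natr1; move: (k.+1%:R : R) xt => m xt m0.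
apply: (@le_trans _ _ ((m + 1) * (c ^+ 2 + t))); last first.
  by rewrite ler_wpM2l ?lerD2r //; lra.
rewrite -(ler_pM2l m0) -subr_ge0.
have -> : m * ((m + 1) * (c ^+ 2 + t)) - m * (c + x) ^+ 2 =
  (m * c - x) ^+ 2 + (m + 1) * (m * t - x ^+ 2) by ring.
by apply: addr_ge0; rewrite ?sqr_ge0 // mulr_ge0 ?subr_ge0 //; lra.
Qed.

Section FractionalPacking.
Context {R : realFieldType} {V I : finType}.
Variables (s : I -> {set V}) (w : I -> R).

Lemma sum_weight_card (F : {set I}) :
  \sum_(B in F) w B * #|s B|%:R = \sum_v \sum_(B in F | v \in s B) w B.
Proof.
rewrite (exchange_big_dep (mem F)) /=; last by move=> v B _ /andP[].
apply: eq_bigr => B BF.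
by under eq_bigl do rewrite BF /=; rewrite sumr_const mulr_natr.
Qed.

(** Summing the vertex constraints over [A] gives at most [#|A|] and counts each member meeting [A]
    at least once. *)
Lemma weight_meeting_le (F : {set I}) (A : {set V}) :
  (forall B, B \in F -> 0 <= w B) ->
  (forall v, \sum_(B in F | v \in s B) w B <= 1) ->
  \sum_(B in F | ~~ [disjoint s B & A]) w B <= #|A|%:R.
Proof.
move=> w0 w1.
have -> : #|A|%:R = \sum_(v in A) 1 :> R by rewrite sumr_const.
apply: le_trans (ler_sum _ (fun v _ => w1 v)).
rewrite (exchange_big_dep (mem F)) /=; last by move=> v B _ /andP[].
rewrite big_mkcondr; apply: ler_sum => B BF.
under eq_bigl do rewrite BF /=.
case: ifPn => [|_]; last by apply: sumr_ge0 => v _; exact: w0.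
rewrite -setI_eq0 => /set0Pn[v]; rewrite inE => /andP[vB vA].
rewrite (bigD1 v) ?vA //= lerDl; apply: sumr_ge0 => u _; exact: w0.
Qed.

(** One greedy choice per induction step, by induction on a bound for [#|F|]; [D] collects the
    chosen members. *)
Lemma fractional_packing (F : {set I}) :
  (forall B, B \in F -> s B != finset.set0) ->
  (forall B, B \in F -> 0 <= w B) ->
  (forall v, \sum_(B in F | v \in s B) w B <= 1) ->
  exists D : {set I}, [/\ D \subset F,
    {in D &, forall B B', B != B' -> [disjoint s B & s B']} &
    (\sum_(B in F) w B) ^+ 2 <= #|D|%:R * \sum_(B in F) w B * #|s B|%:R].
Proof.
move: {2}#|F| (leqnn #|F|) => m; elim: m F => [|m IH] F.
  rewrite leqn0 cards_eq0 => /eqP -> _ _ _; exists finset.set0.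
  by split=> [|B B'|]; rewrite ?sub0set ?inE // !big_set0 expr0n mulr0.
have [-> _ _ _ _|[B0 B0F] Fm s0 w0 w1] := set_0Vmem F.
  exists finset.set0.
  by split=> [|B B'|]; rewrite ?sub0set ?inE // !big_set0 expr0n mulr0.
case: (arg_minnP (fun B => #|s B|) B0F) => A AF Amin; have {}AF : A \in F := AF.
pose F' := [set B in F | [disjoint s B & s A]]%SET.
have sF'F : F' \subset F by apply/fintype.subsetP => B; rewrite inE => /andP[].
have inF B : B \in F' -> B \in F by move/(fintype.subsetP sF'F).
have AF' : A \notin F'.
  (* A nonempty set is not disjoint from itself, so [F'] loses at least [A] and the induction
     hypothesis applies. *)
  by rewrite inE AF /= -setI_eq0 finset.setIid; exact: s0.
have [|B /inF|B /inF|v|D [DF' Ddisj Dle]] := IH F'; [|exact: s0|exact: w0| |].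
- rewrite -ltnS; apply: leq_trans Fm; apply: proper_card.
  by apply/properP; split=> //; exists A.
(* Passing to [F'] only drops nonnegative terms from each vertex constraint. *)
- apply: le_trans (w1 v); rewrite [leRHS](bigID (mem F')) /=.
  rewrite (eq_bigl (fun B => (B \in F) && (v \in s B) && (B \in F'))).
    by rewrite lerDl sumr_ge0 // => B /andP[/andP[/w0]].
  by move=> B; case: (boolP (B \in F')) => [/inF ->|]; rewrite ?andbT ?andbF.
have AD : A \notin D by apply: contra AF' => /(fintype.subsetP DF').
exists (A |: D)%SET; split.
- by rewrite finset.subUset finset.sub1set AF (fintype.subset_trans DF').
- have DA B : B \in D -> [disjoint s B & s A].
    by move/(fintype.subsetP DF'); rewrite inE => /andP[].
  move=> B B'; rewrite !inE => /orP[/eqP ->|BD] /orP[/eqP ->|B'D].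
  + by rewrite eqxx.
  + by rewrite disjoint_sym DA.
  + by rewrite DA.
  + exact: Ddisj.
have split_sum f : \sum_(B in F) f B =
    \sum_(B in F | ~~ [disjoint s B & s A]) f B + \sum_(B in F') f B :> R.
  rewrite (bigID (fun B => ~~ [disjoint s B & s A])) /=; congr (_ + _).
  by apply: eq_bigl => B; rewrite inE negbK.
rewrite cardsU1 AD !split_sum.
(* [c] is the weight discarded together with [A]; it is at most [#|s A|] by [weight_meeting_le]. *)
set c := \sum_(B in F | _) w B.
apply: (@le_trans _ _ (#|D|.+1%:R *
    (c * #|s A|%:R + \sum_(B in F') w B * #|s B|%:R))).
  apply: sqr_add_le => //.
  - by apply: sumr_ge0 => B /andP[/w0].
  - exact: weight_meeting_le.
  - by apply: sumr_ge0 => B /inF/w0 ?; rewrite mulr_ge0.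
(* Minimality of [A]: every discarded member has size at least [#|s A|]. *)
rewrite ler_wpM2l // lerD2r mulr_suml; apply: ler_sum => B /andP[BF _].
by rewrite ler_wpM2l ?w0 // ler_nat Amin.
Qed.

End FractionalPacking.

Section BrambleMinor.
Context {G : sgraph}.

(** Bramble members are arbitrary subgraphs while branch sets are induced ones; the induced subgraph
    keeps all edges of [B], hence its paths. *)
Lemma connected_induced (B : presubgraph G) :
  is_subgraph B -> connected_subgraph B -> connected_subgraph (induced B.1).
Proof.
case/andP=> /fintype.subsetP sub1 /forall_inP sub2 /andP[B0 /forall_inP Bc].
apply/andP; split=> //; apply/forall_inP => x xB; apply/forall_inP => y yB.
have /forall_inP/(_ y yB) := Bc x xB; apply: connect_sub => u v uvB.
by apply: connect1; rewrite /subgraph_adj inE sub1 // sub2.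
Qed.

(** The members of [D] serve as branch sets: disjointness excludes a shared vertex, so touching must
    provide an edge. *)
Lemma disjoint_bramble_minor (BB D : {set presubgraph G}) :
  bramble BB -> D \subset BB ->
  {in D &, forall B B' : presubgraph G, B != B' -> [disjoint B.1 & B'.1]} ->
  minor (complete_graph #|D|) G.
Proof.
case/andP=> /forall_inP BBc /forall_inP BBt /fintype.subsetP DBB Ddisj.
pose phi (u : 'I_#|D|) := (enum_val u).1.
have phiD (u v : 'I_#|D|) : u != v -> [disjoint phi u & phi v].
  move=> uv; apply: Ddisj; rewrite ?enum_valP //.
  by apply: contra uv => /eqP/enum_val_inj ->.
apply/existsP; exists (finfun (phi : complete_graph #|D| -> _)).
apply/and3P; split.
- apply/forallP => u; rewrite ffunE.
  by have /andP[] := BBc _ (DBB _ (enum_valP u)); exact: connected_induced.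
- apply/forallP => u; apply/forallP => v; rewrite !ffunE.
  by apply/implyP => /phiD.
- apply/forallP => u; apply/forallP => v; rewrite !ffunE.
  apply/implyP => /phiD uv.
  have /forall_inP/(_ _ (DBB _ (enum_valP v))) := BBt _ (DBB _ (enum_valP u)).
  by rewrite -/(phi u) -/(phi v) uv.
Qed.

End BrambleMinor.

Theorem theorem3 (R : realType) (G : sgraph) (n : nat) (hn : #|G| = n) :
  frac_hadwiger R G <= Num.sqrt (2 * (hadwiger G)%:R * n%:R).
Proof.
(* The supremum is attained, so it can be replaced by the total of an optimal weighted bramble. *)
have [[BB [w [BBb [w0 w1] ->]]] _] := frac_hadwiger_max R G.
have BB0 B : B \in BB -> B.1 != finset.set0.
  by case/andP: BBb => /forall_inP BBc _ /BBc /andP[_ /andP[]].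
have [D [DBB Ddisj Dle]] := fractional_packing fst w BB BB0 w0 w1.
have Dh : (#|D| <= hadwiger G)%N.
  by apply: (hadwiger_max G).2; exact: disjoint_bramble_minor BBb DBB Ddisj.
(* Double counting: the sum equals the total load over all vertices, each load being at most 1. *)
have Sn : \sum_(B in BB) w B * #|B.1|%:R <= n%:R.
  rewrite sum_weight_card -hn -sum1_card natr_sum.
  by apply: ler_sum => v _; exact: w1.
have W0 : 0 <= \sum_(B in BB) w B by exact: sumr_ge0.
rewrite -(ger0_norm W0) -sqrtr_sqr ler_wsqrtr //; apply: le_trans Dle _.
apply: (@le_trans _ _ ((hadwiger G)%:R * n%:R)).
  apply: ler_pM; rewrite ?ler_nat //.
  by apply: sumr_ge0 => B /w0 ?; rewrite mulr_ge0.
(* The squared weight is already at most [hadwiger G] times [n]; the factor 2 is slack. *)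
by rewrite ler_wpM2r // ler_peMl // ler1n.
Qed.
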